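(* Let $n \geq 2$, $s\in[0,n]$, let $A \subseteq \mathbb{R}^n$ be a bounded set with $\overline{\dim}_{\mathrm{B}} A \leq s$, and let $K_A$ be an $A$-restricted Kakeya set. Then $\dim_{\mathrm{H}} K_A \geq n-s$.
   Context: For $e \in S^{n-1}$ and $a\in\mathbb{R}^n$, let $I_e(a) = \{a + t e : -1/2 \leq t \leq 1/2\}$ be the unit line segment in direction $e$ with midpoint $a$. Given a bounded set $A\subseteq\mathbb{R}^n$, a compact set $K_A\subseteq\mathbb{R}^n$ is an $A$-restricted Kakeya set if for every $e\in S^{n-1}$ there is a point $a_e\in A$ with $I_e(a_e)\subseteq K_A$. $\dim_{\mathrm{H}}$ is Hausdorff dimension, and $\overline{\dim}_{\mathrm{B}} A = \limsup_{\delta\to 0} \frac{\log N_\delta(A)}{-\log\delta}$ is the upper box-counting dimension, where $N_\delta(A)$ is the smallest number of sets of diameter at most $\delta$ needed to cover $A$. *)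

(* Defs.v *)
From HB Require Import structures.
From mathcomp Require Import all_boot all_order all_algebra.
From mathcomp Require Import all_classical all_reals all_analysis.
Set Implicit Arguments.
Unset Strict Implicit.
Unset Printing Implicit Defensive.
Import Order.TTheory GRing.Theory Num.Theory.
Import numFieldNormedType.Exports.
Local Open Scope classical_set_scope.
Local Open Scope ring_scope.

(* Points of R^n are row vectors.  The norm `|x| that MathComp-Analysis puts on
   row vectors is the sup norm, so the Euclidean norm is defined here.  The
   topology of 'rV[R]_n and the notion of bounded set are the same for both. *)
Definition enorm (R : realType) (n : nat) (x : 'rV[R]_n) : R :=
  Num.sqrt (\sum_(i < n) x ord0 i ^+ 2).

Definition unit_sphere (R : realType) (n : nat) : set 'rV[R]_n :=
  [set e | enorm e = 1].

Definition unit_segment (R : realType) (n : nat) (e a : 'rV[R]_n) :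
    set 'rV[R]_n :=
  [set a + t *: e | t in `[- 2^-1, 2^-1]].

Definition restricted_kakeya (R : realType) (n : nat)
    (A K : set 'rV[R]_n) : Prop :=
  compact K /\
  forall e, unit_sphere e -> exists2 a, A a & unit_segment e a `<=` K.

Local Open Scope ereal_scope.

(* Euclidean diameter; the maximum with 0 makes the diameter of set0 equal to 0
   (the supremum of the empty set is -oo). *)
Definition ediam (R : realType) (n : nat) (U : set 'rV[R]_n) : \bar R :=
  maxe 0 (ereal_sup [set (enorm (p.1 - p.2))%:E | p in U `*` U]).

(* It is +oo when A has no finite cover of the required kind. *)
Definition covering_number (R : realType) (n : nat) (delta : R)
    (A : set 'rV[R]_n) : \bar R :=
  ereal_inf [set (k%:R)%:E | k in
    [set k : nat | exists F : 'I_k -> set 'rV[R]_n,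
       (forall i, ediam (F i) <= delta%:E) /\ A `<=` \bigcup_i F i]].

(* lne 0 = -oo, so that the upper box dimension of set0 is -oo. *)
Definition upper_box_dim (R : realType) (n : nat) (A : set 'rV[R]_n) : \bar R :=
  limf_esup
    (fun delta : R => lne (covering_number delta A) / (- ln delta)%:E) 0^'+.

(* The t-th power of the diameter of U.  As 0 `^ 0 = 1, the case distinction
   makes a singleton count for 1 and set0 for 0 when t = 0. *)
Definition ediam_pow (R : realType) (n : nat) (t : R) (U : set 'rV[R]_n) :
    \bar R :=
  if U == set0 then 0 else poweR (ediam U) t.

Definition hausdorff_premeasure (R : realType) (n : nat) (t delta : R)
    (E : set 'rV[R]_n) : \bar R :=
  ereal_inf [set \sum_(0 <= i <oo) ediam_pow t (F i) | F in
    [set F : nat -> set 'rV[R]_n |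
       (forall i, ediam (F i) <= delta%:E) /\ E `<=` \bigcup_i F i]].

(* hausdorff_premeasure t delta E increases as delta decreases to 0, so that the
   supremum is the limit as delta tends to 0. *)
Definition hausdorff_measure (R : realType) (n : nat) (t : R)
    (E : set 'rV[R]_n) : \bar R :=
  ereal_sup [set hausdorff_premeasure t delta E | delta in
    [set delta : R | (0 < delta)%R]].

Definition hausdorff_dim (R : realType) (n : nat) (E : set 'rV[R]_n) : \bar R :=
  ereal_inf [set t%:E | t in
    [set t : R | (0 <= t)%R /\ hausdorff_measure t E = 0]].

(* Main.v *)
(** Every nonzero w with |w| <= 1/2 is t e with e a unit vector and
    0 < t <= 1/2, so a_e + w lies in K with a_e in A: the difference set K - A
    contains a cube.  Suppose K is covered by finitely many open sets U_i of
    diameter about D_i with sum D_i^(n-u) small, for some u > s.  Covering A by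
    at most D_i^(-u) sets B_ij of diameter D_i, the cube is covered by the sets
    U_i - B_ij, whose total volume is at most a constant times
    sum D_i^(-u) D_i^n, a contradiction.  Volumes are replaced by numbers of
    points of a grid finer than all the D_i. *)

Require Import Defs.
From HB Require Import structures.
From mathcomp Require Import all_boot all_order all_algebra.
From mathcomp Require Import all_classical all_reals all_analysis.
From mathcomp Require Import zify lra ring.
Set Implicit Arguments.
Unset Strict Implicit.
Import Order.TTheory GRing.Theory Num.Theory.
Import numFieldNormedType.Exports.
Local Open Scope classical_set_scope.
Local Open Scope ring_scope.

(** * Coordinates, diameters and counting *)

Lemma coord_le_enorm (R : realType) (n : nat) (x : 'rV[R]_n) (j : 'I_n) :
  `|x ord0 j| <= enorm x.
Proof.
rewrite -sqrtr_sqr ler_wsqrtr // (bigD1 j) //= lerDl.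
by apply: sumr_ge0 => i _; exact: sqr_ge0.
Qed.

Lemma ediam_coord (R : realType) (n : nat) (d : R) (U : set 'rV[R]_n) x y j :
  (ediam U <= d%:E)%E -> U x -> U y -> `|x ord0 j - y ord0 j| <= d.
Proof.
move=> Ud Ux Uy.
have -> : x ord0 j - y ord0 j = (x - y) ord0 j by rewrite !mxE.
apply: le_trans (coord_le_enorm _ _) _.
rewrite -lee_fin; apply: le_trans Ud; rewrite /ediam le_max.
by apply/orP; right; apply: ereal_sup_ubound; exists (x, y).
Qed.

Lemma card_le_sum_cover (T : finType) (N : nat) (Q : {pred T})
    (P : nat -> {pred T}) :
  (forall x, x \in Q -> exists2 i, (i < N)%N & x \in P i) ->
  (#|Q| <= \sum_(0 <= i < N) #|P i|)%N.
Proof.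
move=> QP; rewrite -sum1_card.
under [X in (_ <= X)%N]eq_bigr do rewrite -sum1_card big_mkcond /=.
rewrite exchange_big /= [X in (X <= _)%N]big_mkcond /=; apply: leq_sum => x _.
case: ifPn => // /QP[i iN Pi].
by rewrite big_mkord (bigD1 (Ordinal iN)) //= Pi.
Qed.

(** Reducing each coordinate mod [l.+1] is injective on [P]: equal remainders with different
    quotients would force two values at least [l + 1] apart. *)
Lemma card_close_ffun (n M l : nat) (P : {pred {ffun 'I_n -> 'I_M}}) :
  (forall f g, f \in P -> g \in P -> forall j, (f j <= g j + l)%N) ->
  (#|P| <= l.+1 ^ n)%N.
Proof.
move=> close.
pose F (f : {ffun 'I_n -> 'I_M}) : {ffun 'I_n -> 'I_l.+1} :=
  [ffun j => inord (f j %% l.+1)].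
have F_inj : {in P &, injective F}.
  move=> f g Pf Pg /ffunP FE; apply/ffunP => j; apply/val_inj => /=.
  have := congr1 val (FE j); rewrite !ffunE /= !inordK ?ltn_pmod //.
  move: (close f g Pf Pg j) (close g f Pg Pf j).
  have := divn_eq (f j) l.+1; have := divn_eq (g j) l.+1.
  set a := (f j : nat); set b := (g j : nat).
  set qa := (a %/ _)%N; set qb := (b %/ _)%N => Eb Ea ab ba E.
  case: (ltngtP qa qb) => q; last by rewrite Ea Eb q E.
  - have : (qa.+1 * l.+1 <= qb * l.+1)%N by rewrite leq_mul2r q orbT.
    by rewrite mulSn; lia.
  - have : (qb.+1 * l.+1 <= qa * l.+1)%N by rewrite leq_mul2r q orbT.
    by rewrite mulSn; lia.
rewrite -(card_in_imset F_inj); apply: leq_trans (max_card _) _.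
by rewrite card_ffun !card_ord.
Qed.

(** * Covers supplied by the two dimensions *)

(** Near 0 the quotient in the limsup stays below [u]; clearing the logarithms bounds the covering
    number by [d^(-u)]. Indexing by [nat], with the size [k] kept apart, lets covers of different
    sizes form one family. *)
Lemma upper_box_dim_cover (R : realType) (n : nat) (A : set 'rV[R]_n) (s u : R) :
  (upper_box_dim A <= s%:E)%E -> s < u ->
  exists2 d0 : R, 0 < d0 < 1 & forall d, 0 < d < d0 ->
    exists k (B : nat -> set 'rV[R]_n), [/\ k%:R <= d `^ (- u),
      forall i, (ediam (B i) <= d%:E)%E &
      forall x, A x -> exists2 i, (i < k)%N & B i x].
Proof.
move=> dimA su.
have : (upper_box_dim A < u%:E)%E by apply: le_lt_trans dimA _; rewrite lte_fin.
move=> /ereal_inf_lt[_ [V V0 <-] supV].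
have [e /= e0 eV] := V0.
(* The bound [2^-1] keeps [d < 1], so that [- ln d] is positive and can be multiplied out. *)
exists (Num.min e 2^-1) => [|d /andP[d0 dmin]].
  by rewrite lt_min e0 /= gt_min; apply/andP; split; [lra|apply/orP; right; lra].
have [de d2] : d < e /\ d < 2^-1 by move: dmin; rewrite lt_min => /andP.
have Vd : V d by apply: eV => //=; rewrite sub0r normrN gtr0_norm.
have lnd : 0 < - ln d by rewrite oppr_gt0 ln_lt0 // d0; lra.
have : (lne (covering_number d A) / (- ln d)%:E < u%:E)%E.
  by apply: le_lt_trans supV; apply: ereal_sup_ubound; exists d.
rewrite inver gt_eqF // lte_pdivrMr // => lnN.
have : (covering_number d A < (d `^ (- u))%:E)%E.
  rewrite ltNge; apply/negP => le_N; move: lnN; apply/negP; rewrite -leNgt.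
  have pos : 0 < d `^ (- u) by rewrite powR_gt0.
  have -> : (u%:E * (- ln d)%:E = lne (d `^ (- u))%:E)%E.
    by rewrite lne_EFin // ln_powR -EFinM mulrN mulNr.
  by rewrite lee_lne // in_itv /= leey andbT ?lee_fin ?(ltW pos) //;
    apply: le_trans le_N; rewrite lee_fin ltW.
move=> /ereal_inf_lt[_ [k [F [diamF AF]] <-]]; rewrite lte_fin => kd.
(* Indices from [k] on are padded with [set0], of diameter 0. *)
exists k, (fun i => if insub i is Some j then F j else set0); split.
- exact: ltW.
- move=> i; case: insubP => [j _ _|_]; first exact: diamF.
  by rewrite /ediam set0X image_set0 ereal_sup0 max_l ?leNye // lee_fin ltW.
- move=> x /AF[j _ Fj]; exists j => //.
  by rewrite insubT //= => ?; rewrite (_ : Sub _ _ = j) //; exact: val_inj.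
Qed.

(** The exponent [t] comes before [d] and [eta], so that other exponents can be chosen from it
    before the scale and the tolerance are fixed. *)
Lemma hausdorff_dim_cover (R : realType) (n : nat) (K : set 'rV[R]_n) (b : R) :
  (hausdorff_dim K < b%:E)%E ->
  exists2 t : R, 0 <= t < b & forall d eta : R, 0 < d -> 0 < eta ->
    exists F : nat -> set 'rV[R]_n,
    [/\ forall i, (ediam (F i) <= d%:E)%E, K `<=` \bigcup_i F i &
        (\sum_(0 <= i <oo) ediam_pow t (F i) < eta%:E)%E].
Proof.
move=> /ereal_inf_lt[_ [t [t0 Ht] <-]]; rewrite lte_fin => tb.
exists t => [|d eta d0 eta0]; first by rewrite t0.
have : (hausdorff_premeasure t d K < eta%:E)%E.
  apply: (@le_lt_trans _ _ 0%E); last by rewrite lte_fin.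
  by rewrite -Ht; apply: ereal_sup_ubound; exists d.
by move=> /ereal_inf_lt[_ [F [diamF KF] <-] sumF]; exists F.
Qed.

(** * Counting grid points of the cube *)

(** The grid point is recovered as [x f - a f], so the indices of two members of [P] differ by at
    most [L] in each coordinate. This leaves [trunc L + 1] residues per coordinate, at most [2 * L]
    because [1 <= L]. *)
Lemma card_grid_close (R : realType) (n M : nat) (h L : R)
    (x a : {ffun 'I_n -> 'I_M} -> 'rV[R]_n) (P : {pred {ffun 'I_n -> 'I_M}}) :
  0 < h -> 1 <= L ->
  (forall f j, x f ord0 j - a f ord0 j = (f j).+1%:R * h) ->
  (forall f g j, f \in P -> g \in P ->
     `|x f ord0 j - x g ord0 j| + `|a f ord0 j - a g ord0 j| <= L * h) ->
  #|P|%:R <= (2 * L) ^+ n.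
Proof.
move=> h0 L1 xa close.
have /andP[Ll lL] := truncn_itv (le_trans ler01 L1).
have : (#|P| <= (Num.trunc L).+1 ^ n)%N.
  apply: card_close_ffun => f g Pf Pg j.
  rewrite -leq_subLR truncn_ge_nat ?(le_trans ler01) //.
  case: (leqP (f j) (g j)) => [|/ltnW gf].
    by rewrite -subn_eq0 => /eqP ->; exact: le_trans ler01 L1.
  rewrite natrB // -(ler_pM2r h0); apply: le_trans (close f g j Pf Pg).
  have := xa f j; have := xa g j; rewrite -!natr1 => Eg Ef.
  have -> : ((f j)%:R - (g j)%:R) * h = (x f ord0 j - x g ord0 j)
    - (a f ord0 j - a g ord0 j).
    transitivity (((f j)%:R + 1) * h - ((g j)%:R + 1) * h); first by ring.
    by rewrite -Eg -Ef; ring.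
  by apply: le_trans (ler_norm _) _; exact: ler_normB.
rewrite -(ler_nat R) natrX => /le_trans; apply.
rewrite lerXn2r ?nnegrE ?ler0n //; last by rewrite -natr1; lra.
by rewrite mulr_ge0 // (le_trans ler01).
Qed.

(** Each of the [M ^ n] grid points falls in some class [P i j], and each class has at most
    [(16 n M D_i)^n] points. The factor [M ^ n] cancels, so the bound does not depend on the
    grid. *)
Lemma difference_cube_cover_sum (R : realType) (n N : nat) (K A : set 'rV[R]_n)
    (D : nat -> R) (k : nat -> nat) (U : nat -> set 'rV[R]_n)
    (B : nat -> nat -> set 'rV[R]_n) :
  (0 < n)%N ->
  (forall w : 'rV[R]_n, (forall j, 0 < w ord0 j <= (2 * n%:R)^-1) ->
     exists2 a, A a & K (a + w)) ->
  (forall x, K x -> exists2 i, (i < N)%N & U i x) ->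
  (forall i a, A a -> exists2 j, (j < k i)%N & B i j a) ->
  (forall i, 0 < D i) ->
  (forall i x y l, U i x -> U i y -> `|x ord0 l - y ord0 l| <= 3 * D i) ->
  (forall i j x y l, B i j x -> B i j y -> `|x ord0 l - y ord0 l| <= D i) ->
  1 <= (16 * n%:R) ^+ n * \sum_(0 <= i < N) (k i)%:R * D i ^+ n.
Proof.
move=> n0 cube KU AB D0 Uclose Bclose.
(* [M] exceeds every [1 / D i] with [i < N]; this gives the hypothesis [1 <= L] of
   [card_grid_close]. *)
pose M := (\max_(i < N) Num.bound (D i)^-1).+1.
have nR : (0 : R) < n%:R by rewrite ltr0n.
have M0 : (0 : R) < M%:R by rewrite ltr0n.
have MD i : (i < N)%N -> 1 <= M%:R * D i.
  move=> iN; rewrite -ler_pdivrMr // mul1r.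
  have /archi_boundP/ltW/le_trans : 0 <= (D i)^-1 by rewrite invr_ge0 ltW.
  apply; rewrite ler_nat; apply: leqW.
  exact: (leq_bigmax (F := fun i : 'I_N => Num.bound (D i)^-1) (Ordinal iN)).
(* The side [1/(2n)] is cut into [M] steps; the successor in [w] keeps all coordinates positive,
   from [h] to [M h]. *)
pose h : R := (2 * n%:R * M%:R)^-1.
have h0 : 0 < h by rewrite invr_gt0 !mulr_gt0.
pose w (f : {ffun 'I_n -> 'I_M}) : 'rV[R]_n := \row_j ((f j).+1%:R * h).
have wP f j : 0 < w f ord0 j <= (2 * n%:R)^-1.
  rewrite mxE mulr_gt0 ?ltr0n //=.
  have -> : (2 * n%:R)^-1 = M%:R * h.
    by rewrite /h; field; rewrite !gt_eqF.
  by rewrite ler_pM2r // ler_nat ltn_ord.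
have /choice[a aP] : forall f, exists a, A a /\ K (a + w f).
  by move=> f; have [a Aa Ka] := cube _ (wP f); exists a.
pose P i j : {pred {ffun 'I_n -> 'I_M}} :=
  [pred f | `[< U i (a f + w f) /\ B i j (a f) >]].
have cardP i j : (i < N)%N -> #|P i j|%:R <= (16 * n%:R * M%:R * D i) ^+ n.
  (* Here [L = 8 n M D_i], so [L h = 4 D_i], the sum of the spread [3 D_i] in [U i] and [D_i] in
     [B i j]. *)
  move=> iN; have -> : 16 * n%:R * M%:R * D i = 2 * (8 * n%:R * M%:R * D i).
    by ring.
  apply: (@card_grid_close _ _ _ h _ (fun f => a f + w f) a) => //.
  - have n1 : 1 <= n%:R :> R by rewrite ler1n.
    rewrite -mulrA; apply: le_trans (MD i iN) _.
    by rewrite ler_peMl ?(le_trans ler01 (MD i iN)) //; lra.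
  - by move=> f j'; rewrite !mxE; ring.
  move=> f g l /asboolP[Uf Bf] /asboolP[Ug Bg].
  apply: le_trans (lerD (Uclose _ _ _ l Uf Ug) (Bclose _ _ _ _ l Bf Bg)) _.
  rewrite le_eqVlt; apply/orP; left; apply/eqP.
  by rewrite /h; field; rewrite !gt_eqF.
have count : (M ^ n <= \sum_(0 <= i < N) \sum_(0 <= j < k i) #|P i j|)%N.
  have -> : (M ^ n)%N = #|{: {ffun 'I_n -> 'I_M}}| by rewrite card_ffun !card_ord.
  apply: leq_trans
    (@card_le_sum_cover _ N _ (fun i => [pred f | `[< U i (a f + w f) >]]) _) _.
    move=> f _; have [Af Kf] := aP f; have [i iN Ui] := KU _ Kf.
    by exists i => //; apply/asboolP.
  apply: leq_sum => i _; apply: card_le_sum_cover => f /asboolP Uf.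
  have [Af _] := aP f; have [j jk Bj] := AB i _ Af.
  by exists j => //; apply/asboolP.
have Mn0 : (0 : R) < M%:R ^+ n by rewrite exprn_gt0.
rewrite -(ler_pM2l Mn0) mulr1.
move: count; rewrite -(ler_nat R) natrX => /le_trans; apply.
rewrite natr_sum mulrA mulr_sumr !big_mkord; apply: ler_sum => i _.
rewrite natr_sum.
apply: le_trans (_ : \sum_(0 <= j < k i) (16 * n%:R * M%:R * D i) ^+ n <= _).
  by apply: ler_sum => j _; exact: cardP.
rewrite big_const_nat subn0 iter_addr_0 -mulr_natl !exprMn.
by rewrite le_eqVlt; apply/orP; left; apply/eqP; ring.
Qed.

(** * Differences of a Kakeya set and its midpoints *)

Lemma kakeya_difference (R : realType) (n : nat) (A K : set 'rV[R]_n)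
    (w : 'rV[R]_n) :
  restricted_kakeya A K -> 0 < enorm w <= 2^-1 ->
  exists2 a, A a & K (a + w).
Proof.
move=> [_ AK] /andP[w0 w2].
have [|a Aa aK] := AK ((enorm w)^-1 *: w).
  rewrite /unit_sphere /= /enorm.
  under eq_bigr do rewrite mxE exprMn.
  rewrite -mulr_sumr sqrtrM ?sqr_ge0 // sqrtr_sqr gtr0_norm ?invr_gt0 //.
  by rewrite mulVf // gt_eqF.
exists a => //; apply: aK; exists (enorm w).
  by rewrite /= in_itv /= w2 andbT; lra.
by rewrite scalerA divff ?scale1r // gt_eqF.
Qed.

(** Positive coordinates keep [w] away from 0, and the side [1/(2n)] gives
    [|w|^2 <= n/(2n)^2 = 1/(4n) <= 1/4]. *)
Lemma kakeya_difference_cube (R : realType) (n : nat) (A K : set 'rV[R]_n)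
    (w : 'rV[R]_n) :
  (0 < n)%N -> restricted_kakeya A K ->
  (forall j, 0 < w ord0 j <= (2 * n%:R)^-1) ->
  exists2 a, A a & K (a + w).
Proof.
move=> n0 AK wP; apply: kakeya_difference AK _; apply/andP; split.
  have /andP[w0 _] := wP (Ordinal n0).
  apply: lt_le_trans (coord_le_enorm _ (Ordinal n0)).
  by rewrite normr_gt0 gt_eqF.
have n1 : 1 <= n%:R :> R by rewrite ler1n.
rewrite -[leRHS]gtr0_norm ?invr_gt0 // -sqrtr_sqr ler_wsqrtr //.
apply: le_trans (_ : \sum_(i < n) ((2 * n%:R)^-1) ^+ 2 <= _).
  apply: ler_sum => i _; have /andP[w0 w1] := wP i.
  by rewrite lerXn2r // nnegrE ltW // (lt_le_trans w0).
rewrite sumr_const card_ord -[leLHS]mulr_natl.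
have -> : n%:R * (2 * n%:R)^-1 ^+ 2 = 2^-1 ^+ 2 * n%:R^-1 :> R.
  by field; rewrite gt_eqF // (lt_le_trans ltr01).
by rewrite ler_piMr ?sqr_ge0 // invf_le1 // (lt_le_trans ltr01).
Qed.

(** * Choice of scales and conclusion *)

(** For a diameter in [(0, 1]] a larger exponent gives a smaller power. Diameter 0 is harmless since
    [v > 0] makes the left side 0, even when [t = 0]. *)
Lemma fine_ediam_powR_le (R : realType) (n : nat) (U : set 'rV[R]_n) (d t v : R) :
  (ediam U <= d%:E)%E -> d <= 1 -> 0 <= t < v ->
  ((fine (ediam U) `^ v)%:E <= ediam_pow t U)%E.
Proof.
move=> Ud d1 /andP[t0 tv].
have v0 : v != 0 by rewrite gt_eqF // (le_lt_trans t0).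
have U0 : (0 <= ediam U)%E by rewrite /ediam le_max lexx.
rewrite /ediam_pow; case: eqP => [->|_].
  by rewrite /ediam set0X image_set0 ereal_sup0 max_l ?leNye //= powR0.
case: (ediam U) Ud U0 => [r| |] //=; rewrite !lee_fin => rd r0.
move: r0; rewrite le_eqVlt => /predU1P[<-|r0].
  by rewrite powR0 // powR_ge0.
by rewrite ger_powR ?r0 ?(le_trans rd) // ltW.
Qed.

Lemma compact_nat_cover (T : ptopologicalType) (K : set T) (U : nat -> set T) :
  compact K -> (forall i, open (U i)) -> K `<=` \bigcup_i U i ->
  exists N, forall x, K x -> exists2 i, (i < N)%N & U i x.
Proof.
rewrite compact_cover => cK oU KU.
have [//|S _ KS] := cK nat setT U (fun i _ => oU i).
exists (\max_(i <- finmap.enum_fset S) i).+1 => x /KS[i iS Ui]; exists i => //.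
by rewrite ltnS; apply: leq_bigmax_seq.
Qed.

Theorem corollary2p5 (R : realType) (n : nat) (hn : (2 <= n)%N)
    (s : R) (hs : 0 <= s <= n%:R)
    (A : set 'rV[R]_n) (A_bounded : bounded_set A)
    (A_dim : (upper_box_dim A <= s%:E)%E)
    (K_A : set 'rV[R]_n) (hK : restricted_kakeya A K_A) :
  ((n%:R - s)%:E <= hausdorff_dim K_A)%E.
Proof.
have n0 : (0 < n)%N by exact: ltnW.
rewrite leNgt; apply/negP => /hausdorff_dim_cover[t /andP[t0 ts] cover].
(* [u] is the midpoint of [s] and [n - t], hence [v] that of [t] and [n - s]. *)
pose u := (n%:R + s - t) / 2; pose v := n%:R - u.
have su : s < u by rewrite /u; lra.
have tv : t < v by rewrite /v /u; lra.
have v0 : 0 < v by exact: le_lt_trans tv.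
have [d0 /andP[d0_gt0 d0_lt1] box] := upper_box_dim_cover A_dim su.
pose C : R := (16 * n%:R) ^+ n.
have C0 : 0 < C by rewrite exprn_gt0 // mulr_gt0 // ltr0n.
pose d := d0 / 2.
have d_gt0 : 0 < d by rewrite divr_gt0.
have d_lt : d < d0 by rewrite /d; lra.
(* The first bound makes the final total [C * (2 * eta)] at most [1/2]; the second makes every
   [rho i] at most [d]. *)
pose eta := Num.min (4 * C)^-1 (d `^ v).
have eta0 : 0 < eta by rewrite lt_min powR_gt0 // invr_gt0 mulr_gt0.
have [F [diamF KF sumF]] := cover d eta d_gt0 eta0.
(* The [e i] sum to [eta]. The floor [rho i], with [rho i ^ v = e i], gives sets of diameter 0 a
   positive scale [D i] at total cost at most [eta]. *)
pose e i : R := eta / (2 ^ i.+1)%:R.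
have e0 i : 0 < e i by rewrite divr_gt0 // ltr0n expn_gt0.
pose rho i : R := e i `^ v^-1.
have rho0 i : 0 < rho i by exact: powR_gt0.
have rhov i : rho i `^ v = e i.
  by rewrite -powRrM mulVf ?gt_eqF // powRr1 // ltW.
have rhod i : rho i <= d.
  have -> : d = (d `^ v) `^ v^-1 by rewrite -powRrM divff ?gt_eqF // powRr1 // ltW.
  rewrite ge0_ler_powR ?nnegrE ?powR_ge0 ?invr_ge0 // ?(ltW v0) ?(ltW (e0 i)) //.
  apply: le_trans (_ : eta <= _); last by rewrite ge_min lexx orbT.
  by rewrite ler_pdivrMr ?ltr0n ?expn_gt0 // ler_peMr ?(ltW eta0) // ler1n expn_gt0.
pose D i : R := Num.max (fine (ediam (F i))) (rho i).
have D0 i : 0 < D i by rewrite lt_max rho0 orbT.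
have F0 i : (0 <= ediam (F i))%E by rewrite /ediam le_max lexx.
have Ffin i : ediam (F i) \is a fin_num.
  by rewrite ge0_fin_numE //; apply: le_lt_trans (diamF i) (ltry _).
have FD i : (ediam (F i) <= (D i)%:E)%E.
  by rewrite -[leLHS]fineK // lee_fin le_max lexx.
have Dd i : D i <= d by rewrite ge_max rhod andbT -lee_fin fineK.
have powD i : ((D i `^ v)%:E <= ediam_pow t (F i) + (e i)%:E)%E.
  have le1 : ((fine (ediam (F i)) `^ v)%:E <= ediam_pow t (F i))%E.
    by apply: fine_ediam_powR_le (diamF i) _ _; [lra|rewrite t0].
  rewrite /D; case: (leP (fine (ediam (F i))) (rho i)) => _.
    by rewrite rhov leeDr //; apply: le_trans le1; rewrite lee_fin powR_ge0.
  by rewrite -[leLHS]adde0; apply: leeD => //; rewrite lee_fin ltW.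
have sumD N : \sum_(0 <= i < N) D i `^ v <= 2 * eta.
  rewrite -lee_fin -sumEFin.
  have p0 i : (0 <= ediam_pow t (F i))%E.
    by rewrite /ediam_pow; case: ifP => // _; exact: poweR_ge0.
  apply: le_trans (_ : \sum_(0 <= i < N) (ediam_pow t (F i) + (e i)%:E) <= _)%E.
    by apply: lee_sum => i _; exact: powD.
  apply: le_trans (nneseries_lim_ge N _) _.
    by move=> i _ _; rewrite adde_ge0 // lee_fin ltW.
  apply: le_trans (epsilon_trick _ p0 (ltW eta0)) _.
  have -> : 2 * eta = eta + eta by ring.
  by rewrite EFinD leeD2r // ltW.
have /choice[k kP] : forall i, exists k : nat, exists B : nat -> set 'rV[R]_n,
    [/\ k%:R <= D i `^ (- u), forall j, (ediam (B j) <= (D i)%:E)%E &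
    forall x, A x -> exists2 j, (j < k)%N & B j x].
  by move=> i; apply: box; rewrite D0 (le_lt_trans (Dd i)).
have /choice[B BP] := kP.
(* Open sets are needed for compactness; enlarging [F i] by [D i] in the sup norm gives coordinate
   spread at most [3 * D i]. *)
pose U i := \bigcup_(p in F i) ball p (D i).
have [cK _] := hK.
have [N KU] : exists N, forall x, K_A x -> exists2 i, (i < N)%N & U i x.
  apply: compact_nat_cover cK _ _.
    by move=> i; apply: bigcup_open => p _; exact: ball_open.
  move=> x /KF[i _ Fi]; exists i => //; exists x => //; exact: ballxx.
have : 1 <= C * \sum_(0 <= i < N) (k i)%:R * D i ^+ n.
  apply: (@difference_cube_cover_sum _ _ N K_A A D k U B) => //.
  - by move=> w; exact: kakeya_difference_cube.
  - by move=> i a Aa; have [_ _ AB] := BP i; exact: AB.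
  - move=> i x y l [p Fp [_ px]] [q Fq [_ qy]].
    have := ediam_coord l (FD i) Fp Fq.
    have := px ord0 l; have := qy ord0 l; rewrite /ball /= => qy' px' pq.
    have -> : x ord0 l - y ord0 l = (p ord0 l - q ord0 l)
      - (p ord0 l - x ord0 l) + (q ord0 l - y ord0 l) by ring.
    apply: le_trans (ler_normD _ _) _.
    by have := ler_normB (p ord0 l - q ord0 l) (p ord0 l - x ord0 l); lra.
  - by move=> i j x y l; apply: ediam_coord; have [_ +_] := BP i; exact.
apply/negP; rewrite -ltNge.
(* Since [k i <= D_i^(-u)], each term is at most [D_i^(n-u) = D_i^v], and [sumD] applies. *)
apply: le_lt_trans (_ : C * (2 * eta) < 1).
  rewrite ler_pM2l //; apply: le_trans (sumD N); apply: ler_sum => i _.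
  have [kD _ _] := BP i.
  rewrite /v powRD ?gt_eqF ?implybT // powR_mulrn ?(ltW (D0 i)) // mulrC.
  by rewrite ler_pM2l // exprn_gt0.
apply: le_lt_trans (_ : C * (2 * (4 * C)^-1) < 1).
  by rewrite ler_pM2l // ler_pM2l // ge_min lexx.
have -> : C * (2 * (4 * C)^-1) = 2^-1 :> R by field; rewrite gt_eqF.
by lra.
Qed.
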